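(* Let $g$ be a normalized arithmetic function and let $1\le m<n$ be integers. Let $A_{n,m}^{g,1}$ be the coefficient of $x^m$ in $P_n^{g,1}(x)$. Then $$A_{n,m}^{g,1}=\sum_{\mu\vdash n-m}\mathcal{G}(\mu)\,\frac{\ell(\mu)!}{\prod_{j\ge1}\mathfrak{m}_j(\mu)!}\,\binom{n-|\mu|}{\ell(\mu)},$$ where the sum runs over all partitions $\mu$ of $n-m$.
   Context: An arithmetic function is a map $f:\mathbb{N}=\{1,2,\dots\}\to\mathbb{C}$; it is normalized if $f(1)=1$. For a normalized arithmetic function $g$ define polynomials $P_0^{g,1}(x):=1$ and, for $n\ge1$, $P_n^{g,1}(x):=x\sum_{k=1}^n g(k)P_{n-k}^{g,1}(x)$ (this is the recursion $P_n^{g,h}(x)=\frac{x}{h(n)}\sum_{k=1}^n g(k)P^{g,h}_{n-k}(x)$ with $h\equiv1$). Write $P_n^{g,1}(x)=\sum_{m=0}^n A^{g,1}_{n,m}x^m$. For a partition $\mu=(\mu_1,\dots,\mu_r)$ (non-increasing positive integers), $\ell(\mu)=r$ is its length, $|\mu|=\sum\mu_i$ its size, $\mathfrak{m}_j(\mu)=|\{i:\mu_i=j\}|$ the multiplicity of $j$, and $\mathcal{G}(\mu):=\prod_{k=1}^{r}g(\mu_k+1)$; $\mu\vdash N$ means $|\mu|=N$. *)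

(* Defs.v *)
(* The complex numbers are R[i] for an arbitrary model R : realType of the reals. *)
From HB Require Import structures.
From mathcomp Require Import all_boot all_order all_algebra.
From mathcomp Require Import complex.
From mathcomp Require Import reals.

Set Implicit Arguments.
Unset Strict Implicit.
Unset Printing Implicit Defensive.

Import GRing.Theory.
Local Open Scope ring_scope.
Local Open Scope complex_scope.

(* An arithmetic function is modelled by a map on nat; its value at 0 is an
   irrelevant dummy, since every definition below evaluates it only at
   positive integers. *)
Definition arith_fun (R : realType) := nat -> R[i].

Definition normalized (R : realType) (g : arith_fun R) : Prop := g 1%N = 1.

(* The list P_0, ..., P_n of polynomials given by P_0 = 1 and
   P_n = x \sum_(1 <= k <= n) g(k) P_(n-k). *)
Fixpoint Ppolys (R : realType) (g : arith_fun R) (n : nat) : seq {poly R[i]} :=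
  if n is n'.+1 then
    let s := Ppolys g n' in
    rcons s ('X * \sum_(1 <= k < n.+1) g k *: s`_(n - k))
  else [:: 1].

Definition Ppoly (R : realType) (g : arith_fun R) (n : nat) : {poly R[i]} :=
  (Ppolys g n)`_n.

Definition Acoef (R : realType) (g : arith_fun R) (n m : nat) : R[i] :=
  (Ppoly g n)`_m.

Lemma size_Ppolys (R : realType) (g : arith_fun R) n :
  size (Ppolys g n) = n.+1.
Proof. by elim: n => //= n IHn; rewrite size_rcons IHn. Qed.

Lemma nth_Ppolys (R : realType) (g : arith_fun R) n j :
  (j <= n)%N -> (Ppolys g n)`_j = Ppoly g j.
Proof.
elim: n => [|n IHn]; first by case: j.
rewrite leq_eqVlt => /orP[/eqP-> //|lejn].
by rewrite /= nth_rcons size_Ppolys lejn IHn.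
Qed.

Lemma Ppoly0 (R : realType) (g : arith_fun R) : Ppoly g 0 = 1.
Proof. by []. Qed.

Lemma Ppoly_rec (R : realType) (g : arith_fun R) n : (1 <= n)%N ->
  Ppoly g n = 'X * \sum_(1 <= k < n.+1) g k *: Ppoly g (n - k).
Proof.
case: n => // n _.
rewrite {1}/Ppoly /= nth_rcons size_Ppolys ltnn eqxx.
congr (_ * _); apply: eq_big_nat => k /andP[k_gt0 _].
by rewrite nth_Ppolys // leq_subLR -addn1 addnC leq_add2r.
Qed.

Definition is_part_of (N : nat) (mu : seq nat) : bool :=
  [&& sorted geq mu, all (fun k => 0 < k)%N mu & sumn mu == N].

Record intpart (N : nat) : Type := IntPart {
  part_seq :> seq nat;
  intpartP : is_part_of N part_seq
}.

HB.instance Definition _ N := [isSub for @part_seq N].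
HB.instance Definition _ N := [Countable of intpart N by <:].

Lemma leq_part_sumn (s : seq nat) k : k \in s -> (k <= sumn s)%N.
Proof.
elim: s => //= x s IHs; rewrite inE => /orP[/eqP->|/IHs le_k].
  exact: leq_addr.
exact: leq_trans le_k (leq_addl _ _).
Qed.

Lemma leq_size_sumn (s : seq nat) :
  all (fun k => 0 < k)%N s -> (size s <= sumn s)%N.
Proof.
by elim: s => //= x s IHs /andP[x_gt0 /IHs]; rewrite -add1n; apply: leq_add.
Qed.

Lemma size_intpart_code N (mu : intpart N) :
  (size [seq inord k : 'I_N.+1 | k <- mu] <= N)%N.
Proof.
rewrite size_map; case: mu => s /= /and3P[_ s_gt0 /eqP <-].
exact: leq_size_sumn.
Qed.

(* A partition of N has at most N parts, each at most N: this embeds the type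
   of partitions of N in a finite type, over which sums are then available. *)
Definition intpart_code N (mu : intpart N) : N.-bseq 'I_N.+1 :=
  Bseq (size_intpart_code mu).

Definition intpart_decode N (t : N.-bseq 'I_N.+1) : option (intpart N) :=
  insub [seq nat_of_ord k | k <- t].

Lemma intpart_codeK N : pcancel (@intpart_code N) (@intpart_decode N).
Proof.
move=> mu; rewrite /intpart_decode /= -map_comp.
rewrite (_ : map _ mu = val mu) ?valK //.
rewrite -[RHS]map_id; apply/eq_in_map => k k_mu /=.
rewrite inordK // ltnS; case: mu k_mu => s /= /and3P[_ _ /eqP <-].
exact: leq_part_sumn.
Qed.

HB.instance Definition _ N : isFinite (intpart N) :=
  PCanIsFinite (@intpart_codeK N).

(* The multiplicity of j as a part of mu. *)
Definition part_mult (mu : seq nat) (j : nat) : nat := count_mem j mu.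

Definition Gprod (R : realType) (g : arith_fun R) (mu : seq nat) : R[i] :=
  \prod_(k <- mu) g k.+1.

(* The product over all j >= 1 of the factorials of the multiplicities; it stops
   at the size of mu, because larger j are not parts of mu and contribute 0! = 1. *)
Definition mult_fact (mu : seq nat) : nat :=
  (\prod_(1 <= j < (sumn mu).+1) (part_mult mu j)`!)%N.

(* Main.v *)
(* Put F(q) = sum_(k >= 1) g(k) q^k. Unfolding the recursion gives
   A_(n,m) = [q^n] F(q)^m, and since g(1) = 1 this is [q^(n-m)] (1 + H(q))^m with
   H(q) = sum_(k >= 1) g(k+1) q^k. The binomial theorem leaves the coefficients
   [q^N] H(q)^l, which are sums over the compositions of N with l parts; the
   compositions that rearrange a given partition mu number
   l(mu)! / prod_j m_j(mu)!. Power series are truncated to polynomials whose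
   length B exceeds every degree that matters. *)
Require Import Defs.
From mathcomp Require Import all_boot all_order all_algebra.
From mathcomp Require Import complex.
From mathcomp Require Import reals.
Import GRing.Theory.
Local Open Scope ring_scope.
Local Open Scope complex_scope.

Lemma count_rem_mem (T : eqType) (x y : T) (s : seq T) : x \in s ->
  count_mem y s = ((x == y) + count_mem y (rem x s))%N.
Proof. by move=> /perm_to_rem/permP ->. Qed.

(** Indices above every part contribute 0! = 1, so any upper bound on the parts may serve as cutoff.
    This lets [s] and [rem x s] share one range of indices. *)
Lemma mult_factE (s : seq nat) (B : nat) : all (ltn 0) s -> all (geq B) s ->
  mult_fact s = (\prod_(1 <= j < B.+1) (count_mem j s)`!)%N.
Proof.
move=> s_gt0 s_leB; rewrite /mult_fact /part_mult.
have cut M K : all (geq M) s -> (M <= K)%N ->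
    (\prod_(1 <= j < M.+1) (count_mem j s)`! =
     \prod_(1 <= j < K.+1) (count_mem j s)`!)%N.
  move=> /allP s_leM le_MK; rewrite [RHS](big_cat_nat _ (n := M.+1)) //=.
  rewrite [X in (_ * X)%N]big_nat [X in (_ * X)%N]big1 ?muln1 //.
  move=> j /andP[Mj _].
  by rewrite (count_memPn _) //; apply/negP => /s_leM /=; rewrite leqNgt Mj.
transitivity (\prod_(1 <= j < (sumn s + B).+1) (count_mem j s)`!)%N.
  by apply: cut (leq_addr _ _); apply/allP=> k /leq_part_sumn.
by apply/esym/cut => //; apply: leq_addl.
Qed.

(** Removing one [x] lowers only its own multiplicity, from c to c - 1, and c! = c (c - 1)!. *)
Lemma mult_fact_rem (x : nat) (s : seq nat) : all (ltn 0) s -> x \in s ->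
  mult_fact s = (count_mem x s * mult_fact (rem x s))%N.
Proof.
move=> s_gt0 s_x; pose B := sumn s.
have s_leB : all (geq B) s by apply/allP=> k /leq_part_sumn.
have sub_rem P : all P s -> all P (rem x s).
  by move=> /allP sP; apply/allP => k /mem_rem /sP.
rewrite !(@mult_factE _ B) ?sub_rem //.
have x_in : x \in index_iota 1 B.+1.
  rewrite mem_index_iota ltnS; apply/andP; split.
    exact: (allP s_gt0).
  exact: (allP s_leB).
rewrite !(bigD1_seq x) ?iota_uniq //= mulnA; congr (_ * _)%N.
  by rewrite (count_rem_mem _ _ _ _ s_x) eqxx add1n factS.
apply: eq_bigr => j j_x.
by rewrite (count_rem_mem _ _ _ _ s_x) eq_sym (negPf j_x).
Qed.

(** Induction on the length: sort the rearrangements by their first entry [x]; what follows is a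
    rearrangement of [rem x s]. *)
Lemma size_permutations_mult_fact (s : seq nat) : all (ltn 0) s ->
  (size (permutations s) * mult_fact s = (size s)`!)%N.
Proof.
have [l] := ubnP (size s); elim: l s => // l IHl s; rewrite ltnS => le_s s_gt0.
have [/size0nil->|nt_s] := posnP (size s); first by rewrite /mult_fact big_nil.
rewrite (perm_size (permutationsE nt_s)) size_allpairs_dep sumnE big_map.
rewrite big_distrl -{1}(prednK nt_s) factS (prednK nt_s).
(* The leading factor of (size s)! is split over the distinct entries, to be compared term by term
   with the choices of first entry. *)
have {1}-> : size s = (\sum_(x <- undup s) count_mem x s)%N.
  rewrite -[LHS](sum1_size s) -big_undup_iterop_count.
  by apply: eq_bigr => x _; rewrite Monoid.iteropE iter_addn_0 mul1n.
rewrite big_distrl big_seq [RHS]big_seq; apply: eq_bigr => x.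
rewrite mem_undup /= => s_x.
rewrite (mult_fact_rem _ _ s_gt0 s_x) mulnCA IHl ?size_rem ?prednK //.
by apply/allP => k /mem_rem /(allP s_gt0).
Qed.

(** Expanding the power gives one monomial per map [f], i.e. per composition with [l] parts in 1..B;
    these are grouped by their sorted form. As N <= B, no composition of [N] is lost to
    truncation. *)
Lemma coef_exp_sum_partitions (R : comNzRingType) (a : nat -> R) (B l N : nat) :
  (N <= B)%N ->
  ((\sum_(k < B) a k.+1 *: 'X^(k.+1)) ^+ l)`_N =
  \sum_(mu : intpart N | size mu == l)
     (\prod_(k <- mu) a k) *+ size (permutations mu).
Proof.
move=> le_NB; set h := \sum_(k < B) _.
have -> : h ^+ l = \prod_(i < l) h by rewrite prodr_const card_ord.
rewrite bigA_distr_bigA /= {h}.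
pose s (f : {ffun 'I_l -> 'I_B}) := [seq (f i).+1 | i : 'I_l].
have sort_part f : sumn (s f) == N -> is_part_of N (sort geq (s f)).
  move=> s_N; rewrite /is_part_of sort_sorted; last first.
    by move=> i j; apply: leq_total.
  rewrite all_sort all_map /=; apply/andP; split; first by apply/allP.
  by rewrite (perm_sumn (permEl (perm_sort _ _))).
(* Only a default value for [insubd], taken when [s f] does not sum to [N]. *)
have part0 : is_part_of N (nseq N 1%N).
  rewrite /is_part_of sumn_nseq mul1n eqxx all_nseq orbT !andbT.
  by elim: N {le_NB sort_part} => // -[|N].
pose p f : intpart N := insubd (IntPart part0) (sort geq (s f)).
have prod_s (f : {ffun 'I_l -> 'I_B}) :
    \prod_i (a (f i).+1 *: 'X^((f i).+1)) =
    (\prod_(k <- s f) a k) *: 'X^(sumn (s f)).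
  by rewrite scaler_prod prodrXr big_image sumnE big_image.
transitivity (\sum_(f | sumn (s f) == N) \prod_(k <- s f) a k).
  rewrite coef_sum [RHS]big_mkcond; apply: eq_bigr => f _.
  by rewrite (prod_s f) coefZ coefXn eq_sym mulr_natr mulrb.
rewrite (partition_big p (fun mu => size mu == l)) /=; last first.
  move=> f /sort_part f_part; rewrite val_insubd f_part size_sort size_map.
  by rewrite -cardE card_ord.
apply: eq_bigr => mu /eqP size_mu.
have fiber f : (sumn (s f) == N) && (p f == mu) = perm_eq (s f) mu.
  apply/andP/idP => [[/sort_part f_part /eqP <-]|s_mu].
    by rewrite val_insubd f_part perm_sym perm_sort.
  have /and3P[mu_sorted _ mu_N] := intpartP mu.
  rewrite (perm_sumn s_mu); split=> //.
  have f_part : is_part_of N (sort geq (s f)).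
    by apply: sort_part; rewrite (perm_sumn s_mu).
  apply/eqP/val_inj; rewrite val_insubd f_part.
  apply: (sorted_eq (leT := geq)) => //.
  - by move=> i j k ji kj; apply: leq_trans kj ji.
  - by move=> i j /anti_leq.
  - by apply: sort_sorted => i j; apply: leq_total.
  - by rewrite perm_sort.
under eq_bigl do rewrite fiber.
under eq_bigr => f f_mu do rewrite (perm_big _ f_mu).
rewrite sumr_const; congr (_ *+ _).
(* The injective map [s] carries the fiber over [mu] onto the rearrangements of [mu]. *)
rewrite cardE -(size_map s); apply/perm_size/uniq_perm.
- rewrite map_inj_uniq ?enum_uniq // => f1 f2 /eq_in_map f12.
  by apply/ffunP => i; apply/val_inj/succn_inj/f12; rewrite mem_enum.
- exact: permutations_uniq.
move=> t; rewrite mem_permutations; apply/mapP/idP => [[f]|t_mu].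
  by rewrite mem_enum => f_mu ->.
have /and3P[_ /allP mu_gt0 mu_N] := intpartP mu.
have size_t : size t = l by rewrite (perm_size t_mu).
(* The preimage of [t] takes predecessors of its entries, which must be indices below [B]. *)
have t_bound (i : 'I_l) : (0 < nth 0 t i <= B)%N.
  have t_i : nth 0%N t i \in (mu : seq nat).
    by rewrite -(perm_mem t_mu) mem_nth ?size_t.
  by rewrite mu_gt0 // (leq_trans (leq_part_sumn t_i)) // (eqP mu_N).
have t_ltB (i : 'I_l) : ((nth 0 t i).-1 < B)%N.
  by have /andP[i_gt0] := t_bound i; rewrite -{1}(prednK i_gt0).
pose f := [ffun i => Ordinal (t_ltB i)].
have s_f : s f = t.
  apply: (@eq_from_nth _ 0%N) => [|i];
    rewrite size_map -cardE card_ord ?size_t //.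
  move=> lt_il; rewrite (nth_map (Ordinal lt_il)) ?size_enum_ord // ffunE /=.
  rewrite nth_enum_ord // prednK //.
  by have /andP[] := t_bound (Ordinal lt_il).
by exists f; rewrite // mem_enum unfold_in s_f.
Qed.

(** Induction on [m]: splitting one factor off the power yields a convolution with the values of
    [g], which is the recursion for [Ppoly]. *)
Lemma coef_Ppoly_expX (R : realType) (g : arith_fun R) (B n m : nat) :
  (n <= B)%N ->
  (Ppoly g n)`_m = (('X * \poly_(k < B) g k.+1) ^+ m)`_n.
Proof.
set Q := \poly_(k < B) _; elim: m n => [|m IHm] [|n] le_nB.
- by rewrite Ppoly0 expr0.
- by rewrite Ppoly_rec // coefXM expr0 coef1.
- by rewrite Ppoly0 coef1 exprS -mulrA coefXM.
rewrite Ppoly_rec // exprS -mulrA !coefXM /= coefM big_add1 /= big_mkord coef_sum.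
apply: eq_bigr => k _; rewrite coefZ coef_poly subSS.
rewrite (leq_trans (ltn_ord k)) // IHm //.
by rewrite (leq_trans (leq_subr _ _)) // ltnW.
Qed.

Lemma coef_exp_poly_partitions (R : comNzRingType) (a : nat -> R) (B m N : nat) :
  a 0%N = 1 -> (N <= B)%N ->
  ((\poly_(k < B.+1) a k) ^+ m)`_N =
  \sum_(mu : intpart N)
     (\prod_(k <- mu) a k) *+ (size (permutations mu) * 'C(m, size mu)).
Proof.
move=> a0 le_NB; rewrite poly_def big_ord_recl a0 scale1r expr0 addrC exprD1n.
rewrite coef_sum.
(* With the length condition moved into the summand the sums can be exchanged; each [mu] then
   survives only at i = [size mu]. *)
transitivity (\sum_(i < m.+1) \sum_(mu : intpart N)
    if size mu == i
    then (\prod_(k <- mu) a k) *+ (size (permutations mu) * 'C(m, size mu))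
    else 0).
  apply: eq_bigr => i _.
  rewrite coefMn (coef_exp_sum_partitions _ _ _ _ _ le_NB) -sumrMnl big_mkcond.
  by apply: eq_bigr => mu _; case: eqP => // ->; rewrite mulrnA.
rewrite exchange_big /=; apply: eq_bigr => mu _; rewrite -big_mkcond /=.
(* If [mu] has more than [m] parts, no index [i] matches, and the binomial coefficient vanishes
   too. *)
have [le_mu_m|lt_m_mu] := leqP (size mu) m.
  by rewrite (big_pred1 (Ordinal (le_mu_m : (size mu < m.+1)%N))).
by rewrite bin_small // muln0 mulr0n big1.
Qed.

Theorem theorem1 (R : realType) (g : arith_fun R) (n m : nat)
  (hg : normalized g) (hm : (1 <= m)%N) (hmn : (m < n)%N) :
  Acoef g n m =
  \sum_(mu : intpart (n - m))
     Gprod g mu * ((size mu)`!%:R / (mult_fact mu)%:R)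
     * 'C(n - sumn mu, size mu)%:R.
Proof.
rewrite /Acoef (@coef_Ppoly_expX _ _ n.+1) // exprMn_comm; last exact: mulrC.
rewrite coefXnM ltnNge (ltnW hmn) /=.
rewrite (coef_exp_poly_partitions _ (fun k => g k.+1)) ?leq_subr //.
apply: eq_bigr => mu _.
have /and3P[_ mu_gt0 /eqP ->] := intpartP mu.
(* Here n - |mu| = m, and the quotient of factorials is the number of rearrangements of [mu]. *)
rewrite (subKn (ltnW hmn)) -(size_permutations_mult_fact _ mu_gt0) natrM mulfK.
  by rewrite -mulr_natr natrM mulrA.
rewrite Num.Theory.pnatr_eq0 -lt0n.
by apply: prodn_gt0 => j; apply: fact_gt0.
Qed.
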